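(* Let $\underline{A},\overline{A}\in\mathbb{R}^{n\times n}$ with $\underline{A}\le\overline{A}$ (entrywise), let $\mathbf{A}=\{A\in\mathbb{R}^{n\times n} : \underline{A}\le A\le\overline{A}\}$, and let $A^c=\frac12(\underline{A}+\overline{A})$, $A^\Delta=\frac12(\overline{A}-\underline{A})$. Then $\mathbf{A}$ is strongly column sufficient if and only if the matrix $A_{ss}=A^c-D_sA^\Delta D_s$ is column sufficient for each $s\in\{\pm1\}^n$.
   Context: Inequalities between vectors or matrices are entrywise; $x\lneqq y$ means $x\le y$ and $x\ne y$. A matrix property holds strongly for an interval matrix $\mathbf{A}$ if it holds for every $A\in\mathbf{A}$. $D_s$ is the diagonal matrix with diagonal entries $s_1,\dots,s_n$. For index sets $I,J$, $A_{I,J}$ is the submatrix of $A$ with rows indexed by $I$ and columns indexed by $J$. A matrix $A\in\mathbb{R}^{n\times n}$ is column sufficient if for each pair of disjoint index sets $I,J\subseteq\{1,\dots,n\}$ with $I\cup J\ne\emptyset$ the system $$\begin{pmatrix}A_{I,I}&-A_{I,J}\\-A_{J,I}&A_{J,J}\end{pmatrix}x\lneqq0,\quad x>0$$ is infeasible. *)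

(* Defs.v *)
From mathcomp Require Import all_boot all_order all_algebra.
From mathcomp Require Import reals.

Set Implicit Arguments.
Unset Strict Implicit.
Unset Printing Implicit Defensive.

Import Order.TTheory GRing.Theory Num.Theory.
Local Open Scope ring_scope.

Definition mx_le (R : realType) (m n : nat) (A B : 'M[R]_(m, n)) : Prop :=
  forall i j, A i j <= B i j.

Definition mx_lt (R : realType) (m n : nat) (A B : 'M[R]_(m, n)) : Prop :=
  forall i j, A i j < B i j.

(* Not [mx_lt]: only one entry needs to be strictly smaller. *)
Definition mx_lneqq (R : realType) (m n : nat) (A B : 'M[R]_(m, n)) : Prop :=
  mx_le A B /\ A <> B.

(* A_{I,J}, with the elements of I and J listed in increasing order. *)
Definition submx_set (R : realType) (n : nat) (I J : {set 'I_n})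
    (A : 'M[R]_n) : 'M[R]_(#|I|, #|J|) :=
  mxsub (fun i : 'I_#|I| => enum_val i) (fun j : 'I_#|J| => enum_val j) A.

Definition column_sufficient (R : realType) (n : nat) (A : 'M[R]_n) : Prop :=
  forall I J : {set 'I_n}, [disjoint I & J] -> I :|: J != set0 ->
  ~ exists x : 'cV[R]_(#|I| + #|J|),
      mx_lneqq (block_mx (submx_set I I A) (- submx_set I J A)
                         (- submx_set J I A) (submx_set J J A) *m x) 0
      /\ mx_lt 0 x.

Definition interval_mx (R : realType) (m n : nat) (Al Au : 'M[R]_(m, n)) :
    'M[R]_(m, n) -> Prop :=
  fun A => mx_le Al A /\ mx_le A Au.

Definition strongly (R : realType) (m n : nat) (P : 'M[R]_(m, n) -> Prop)
    (IA : 'M[R]_(m, n) -> Prop) : Prop :=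
  forall A, IA A -> P A.

Definition mx_center (R : realType) (m n : nat) (Al Au : 'M[R]_(m, n)) :
    'M[R]_(m, n) :=
  2^-1 *: (Al + Au).

Definition mx_radius (R : realType) (m n : nat) (Al Au : 'M[R]_(m, n)) :
    'M[R]_(m, n) :=
  2^-1 *: (Au - Al).

Definition sign_vector (R : realType) (n : nat) (s : 'rV[R]_n) : Prop :=
  forall i, s 0 i = 1 \/ s 0 i = -1.

(* Main.v *)
(** For disjoint I and J, let s be 1 on I and -1 elsewhere. In the block matrix
    testing column sufficiency on (I, J), the diagonal blocks of A_ss are those
    of the lower bound and the off-diagonal ones those of the upper bound, so
    with the signs included A_ss gives the entrywise least block matrix over the
    whole interval. Multiplying by x > 0 preserves this order, so a violation by
    any member of the interval is a violation by A_ss. *)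
Require Import Defs.
From mathcomp Require Import all_boot all_order all_algebra.
From mathcomp Require Import reals lra.
Import Order.TTheory GRing.Theory Num.Theory.
Local Open Scope ring_scope.

Lemma mx_le_opp2 (R : realType) (m n : nat) (A B : 'M[R]_(m, n)) :
  mx_le A B -> mx_le (- B) (- A).
Proof. by move=> leAB i j; rewrite !mxE lerN2. Qed.

Lemma mx_le_block_mx (R : realType) (m1 m2 n1 n2 : nat)
    (A1 A2 : 'M[R]_(m1, n1)) (B1 B2 : 'M[R]_(m1, n2))
    (C1 C2 : 'M[R]_(m2, n1)) (D1 D2 : 'M[R]_(m2, n2)) :
  mx_le A1 A2 -> mx_le B1 B2 -> mx_le C1 C2 -> mx_le D1 D2 ->
  mx_le (block_mx A1 B1 C1 D1) (block_mx A2 B2 C2 D2).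
Proof.
move=> hA hB hC hD i j.
by case: (split_ordP i) => i' ->; case: (split_ordP j) => j' ->;
  rewrite ?block_mxEul ?block_mxEur ?block_mxEdl ?block_mxEdr.
Qed.

(** Since [x] is positive, [N *m x <= M *m x <= 0]. Strictness survives as well: [N *m x = 0] would
    squeeze [M *m x] to 0. *)
Lemma mx_lneqq0_mulmx (R : realType) (m n : nat) (M N : 'M[R]_(m, n))
    (x : 'cV[R]_n) :
  mx_le N M -> mx_lt 0 x -> mx_lneqq (M *m x) 0 -> mx_lneqq (N *m x) 0.
Proof.
move=> leNM x_gt0 [Mx_le0 Mx_neq0].
have leNMx : mx_le (N *m x) (M *m x).
  move=> i j; rewrite !mxE; apply: ler_sum => k _.
  apply: ler_wpM2r => //; apply: ltW.
  by have := x_gt0 k j; rewrite mxE.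
split=> [i j|Nx0]; first exact: le_trans (leNMx i j) (Mx_le0 i j).
apply: Mx_neq0; apply/matrixP => i j; apply: le_anti.
by rewrite Mx_le0 -Nx0 leNMx.
Qed.

Lemma submx_setE (R : realType) (n : nat) (I J : {set 'I_n}) (A : 'M[R]_n)
    (i : 'I_#|I|) (j : 'I_#|J|) :
  submx_set I J A i j = A (enum_val i) (enum_val j).
Proof. exact: mxE. Qed.

Lemma mx_center_sub_signE (R : realType) (n : nat) (Al Au : 'M[R]_n)
    (s : 'rV[R]_n) (i j : 'I_n) :
  (mx_center Al Au - diag_mx s *m mx_radius Al Au *m diag_mx s) i j =
  2^-1 * (Al i j + Au i j) - s 0 i * (2^-1 * (Au i j - Al i j)) * s 0 j.
Proof. by rewrite mul_diag_mx mul_mx_diag !mxE. Qed.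

(** Each entry is an endpoint of its interval: [Al i j] if the signs [s 0 i] and [s 0 j] agree,
    [Au i j] if they differ. *)
Lemma interval_mx_center_sub_sign (R : realType) (n : nat) (Al Au : 'M[R]_n)
    (s : 'rV[R]_n) :
  mx_le Al Au -> sign_vector s ->
  interval_mx Al Au
    (mx_center Al Au - diag_mx s *m mx_radius Al Au *m diag_mx s).
Proof.
move=> hA hs; split=> i j; rewrite mx_center_sub_signE; have := hA i j;
  by case: (hs i) => ->; case: (hs j) => ->; lra.
Qed.

Theorem proposition11 (R : realType) (n : nat) (Al Au : 'M[R]_n)
    (hA : mx_le Al Au) :
  strongly (@column_sufficient R n) (interval_mx Al Au) <->
  (forall s : 'rV[R]_n, sign_vector s ->
     column_sufficient
       (mx_center Al Au - diag_mx s *m mx_radius Al Au *m diag_mx s)).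
Proof.
split=> [hstrong s hs|hsign A [leAlA leAAu] I J dIJ IJn0 [x [Ax_lt0 x_gt0]]].
  exact/hstrong/interval_mx_center_sub_sign.
pose s : 'rV[R]_n := \row_i (if i \in I then 1 else -1).
have hs : sign_vector s by move=> i; rewrite mxE; case: ifP; [left|right].
have sI (i : 'I_#|I|) : s 0 (enum_val i) = 1 by rewrite mxE enum_valP.
have sJ (j : 'I_#|J|) : s 0 (enum_val j) = -1.
  by rewrite mxE (disjointFl dIJ (enum_valP j)).
apply: (hsign s hs I J dIJ IJn0); exists x; split=> //.
apply: mx_lneqq0_mulmx Ax_lt0 => //.
(* The [try] acts on the two negated blocks only, where it reverses the inequality to be shown:
   there the entry of [A] must lie below that of [Au], in the diagonal blocks above that of [Al]. *)
apply: mx_le_block_mx; try apply: mx_le_opp2; move=> i j;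
  rewrite !submx_setE mx_center_sub_signE ?sI ?sJ;
  have := leAlA (enum_val i) (enum_val j);
  have := leAAu (enum_val i) (enum_val j); lra.
Qed.
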